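(* Let $X_1,X_2,Y$ be real Banach spaces and let $X=X_1\oplus_\infty X_2$. If $T: X\to Y$ is a narrow operator on $X$, then its restrictions $T_1: X_1\to Y$, $T_1x_1=T(x_1,0)$, and $T_2: X_2\to Y$, $T_2x_2=T(0,x_2)$, are narrow operators on $X_1$ and $X_2$, respectively.
   Context: All Banach spaces are real; $S(X)$ denotes the unit sphere of $X$. $X_1\oplus_\infty X_2$ is the direct sum with norm $\|(x_1,x_2)\|=\max\{\|x_1\|,\|x_2\|\}$. A bounded linear operator $T$ from a Banach space $X$ to some Banach space $Y$ is called a narrow operator (on $X$) if for all $x,y\in S(X)$, every $x^*\in X^*$ and every $\varepsilon>0$ there is $z\in S(X)$ with $\|x+z\|\ge 2-\varepsilon$ and $\|T(y-z)\|+|x^*(y-z)|\le\varepsilon$. *)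

(* Defs.v *)
From HB Require Import structures.
From mathcomp Require Import all_boot all_order all_algebra.
From mathcomp Require Import all_classical all_reals all_analysis.

Set Implicit Arguments.
Unset Strict Implicit.
Unset Printing Implicit Defensive.

Import Order.TTheory GRing.Theory Num.Theory.
Import numFieldNormedType.Exports.

Local Open Scope classical_set_scope.
Local Open Scope ring_scope.

(* The library equips U * V with the norm `|(u, v)| = max `|u| `|v|
   (prod_normE); only its completeness is missing. *)
Section prod_complete.
Variables U V : completeType.

HB.instance Definition _ := Pointed.on (U * V)%type.

Lemma prod_complete (F : set_system (U * V)) :
  ProperFilter F -> cauchy F -> cvg F.
Proof.
move=> FF Fc.
have c1 : cauchy (fst @ F).
  move=> A entA; rewrite near_simpl -near2E near_map2.
  apply: Fc; exists (A, setT) => /=; first by split => //; exact: filterT.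
  by move=> [[a b] [c d]] /= [h _]; exists ((a, c), (b, d)).
have c2 : cauchy (snd @ F).
  move=> A entA; rewrite near_simpl -near2E near_map2.
  apply: Fc; exists (setT, A) => /=; first by split => //; exact: filterT.
  by move=> [[a b] [c d]] /= [_ h]; exists ((a, c), (b, d)).
have /cvg_ex[l1 h1] : cvg (fst @ F) by apply: cauchy_cvg.
have /cvg_ex[l2 h2] : cvg (snd @ F) by apply: cauchy_cvg.
apply/cvg_ex; exists (l1, l2) => W [[P Q] /= [hP hQ]] PQ.
near=> p; apply: PQ; split; near: p; [exact: h1|exact: h2].
Unshelve. all: by end_near. Qed.

HB.instance Definition _ := Uniform_isComplete.Build (U * V)%type prod_complete.

End prod_complete.

HB.instance Definition _ (R : realType) (U V : completeNormedModType R) :=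
  Complete.on (U * V)%type.

Section narrow.
Variable R : realType.

Definition unit_sphere (X : normedModType R) : set X := [set x | `|x| = 1].

Definition bounded_linear (X Y : normedModType R) (T : X -> Y) : Prop :=
  linear T /\ exists M : R, forall x, `|T x| <= M * `|x|.

(* A functional in the dual of X is a bounded linear map into R^o, that is,
   R viewed as a normed space over itself. *)
Definition narrow (X Y : completeNormedModType R) (T : X -> Y) : Prop :=
  bounded_linear T /\
  forall x y : X, unit_sphere x -> unit_sphere y ->
  forall f : X -> R^o, bounded_linear f ->
  forall e : R, 0 < e ->
  exists2 z : X, unit_sphere z &
    2 - e <= `|x + z| /\ `|T (y - z)| + `|f (y - z)| <= e.

End narrow.

(* Main.v *)
Require Import Defs.
From mathcomp Require Import all_boot all_order all_algebra.
From mathcomp Require Import all_classical all_reals all_analysis.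
From mathcomp Require Import lra.

Set Implicit Arguments.
Unset Strict Implicit.
Unset Printing Implicit Defensive.

Import Order.TTheory GRing.Theory Num.Theory.
Import numFieldNormedType.Exports.
Local Open Scope ring_scope.

(** Let x, y be unit vectors of X1 and f a functional on X1.  Narrowness of T
    at (x, 0) and (y, 0) yields z = (z1, z2) with T z close to T (y, 0), and
    the first coordinate is responsible for |(x, 0) + z| being almost 2, because
    |z2| <= 1.  But z1 alone need not do the job: T (y - z1, 0) is close to
    T (0, z2), over which there is no control.

    The way out is to average.  Once z^(1), ..., z^(k) are chosen, apply
    narrowness again with (y, z2^(k)) in place of (y, 0): this is still a unit
    vector of the max-norm sum.  Since
      T (y - z1^(k+1), z2^(k) - z2^(k+1))
    is small at every stage, the second coordinates telescope in the sum, and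
    the norm of T (n y - (z1^(1) + ... + z1^(n)), 0) is at most |T| plus n small
    errors.  Division by n leaves |T| / n plus one small error.

    To keep the average at distance almost 2 from - x, the first vector fed to the
    narrowness of T at each stage is the direction of
      n x + z1^(1) + ... + z1^(k),
    whose norm then increases by almost 1 each time (narrow_telescope).  After n
    stages it is almost 2 n, so the average p of the z1^(i) satisfies
    |x + p| close to 2; hence |p| is close to 1 and p may be normalised
    (narrow_inl).  The second summand is obtained by exchanging the two
    factors. *)

Section bounded_linear_facts.
Variables (R : realType) (X Y : normedModType R) (T : X -> Y).
Hypothesis Tlin : linear T.

Lemma linear_fun0 : T 0 = 0.
Proof.
by have := Tlin (-1) 0 0; rewrite scaler0 addr0 scaleN1r addNr.
Qed.

Lemma linear_funD u v : T (u + v) = T u + T v.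
Proof. by have := Tlin 1 u v; rewrite !scale1r. Qed.

Lemma linear_funZ a u : T (a *: u) = a *: T u.
Proof. by have := Tlin a u 0; rewrite linear_fun0 !addr0. Qed.

Lemma linear_funB u v : T (u - v) = T u - T v.
Proof. by rewrite -scaleN1r linear_funD linear_funZ scaleN1r. Qed.

End bounded_linear_facts.

Lemma bounded_linear_ge0 (R : realType) (X Y : normedModType R) (T : X -> Y) :
  bounded_linear T -> exists2 M : R, 0 <= M & forall x, `|T x| <= M * `|x|.
Proof.
move=> [_ [M hM]]; exists `|M| => // x.
by apply: le_trans (hM x) _; rewrite ler_wpM2r ?ler_norm.
Qed.

Lemma bounded_linear_comp (R : realType) (X Y Z : normedModType R)
    (S : X -> Y) (T : Y -> Z) :
  bounded_linear S -> bounded_linear T -> bounded_linear (T \o S).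
Proof.
move=> Sb Tb; have [M M0 hM] := bounded_linear_ge0 Sb.
have [N N0 hN] := bounded_linear_ge0 Tb.
move: Sb Tb => [Slin _] [Tlin _]; split=> [a u v|] /=; first by rewrite Slin Tlin.
exists (N * M) => x; apply: le_trans (hN _) _.
by rewrite -mulrA ler_wpM2l.
Qed.

Section pair_norm.
Variables (R : realType) (U V : normedModType R).

Lemma norm_pairE (u : U) (v : V) : `|(u, v)| = Num.max `|u| `|v|.
Proof. by rewrite prod_normE. Qed.

Lemma bounded_linear_inl : bounded_linear (fun u : U => (u, 0 : V)).
Proof.
split=> [a u v|]; last first.
  by exists 1 => x; rewrite norm_pairE normr0 mul1r max_l.
by apply: injective_projections => //=; rewrite scaler0 addr0.
Qed.

Lemma bounded_linear_fst : bounded_linear (fst : U * V -> U).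
Proof.
split=> [a [u v] [u' v']|] //.
by exists 1 => -[u v]; rewrite norm_pairE mul1r le_max lexx.
Qed.

Lemma bounded_linear_swap : bounded_linear (fun p : U * V => (p.2, p.1)).
Proof.
split=> [a [u v] [u' v']|] //.
by exists 1 => -[u v]; rewrite !norm_pairE mul1r maxC.
Qed.

End pair_norm.

(** Expresses that z is almost aligned with u itself and not only with its
    direction: u + z is |u| (u / |u| + z) minus (|u| - 1) z, and the second
    term costs at most |u| - 1. *)
Lemma norm_add_near_direction (R : realType) (X : normedModType R) (u z : X)
    (d : R) :
  1 <= `|u| -> `|z| <= 1 -> 2 - d <= `| `|u|^-1 *: u + z| ->
  `|u| + 1 - d * `|u| <= `|u + z|.
Proof.
move=> u1 z1 huz; have u0 : 0 < `|u| by apply: lt_le_trans u1.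
have -> : u + z = `|u| *: (`|u|^-1 *: u + z) - (`|u| - 1) *: z.
  rewrite scalerDr scalerA divff ?gt_eqF// scale1r scalerBl scale1r opprB.
  by rewrite addrACA subrr addr0.
apply: le_trans (lerB_dist _ _).
rewrite !normrZ normr_id ger0_norm ?subr_ge0//.
have h1 : `|u| * (2 - d) <= `|u| * `| `|u|^-1 *: u + z|.
  by rewrite ler_wpM2l.
have h2 : (`|u| - 1) * `|z| <= `|u| - 1 by rewrite ler_piMr ?subr_ge0.
lra.
Qed.

Section narrow_sum.
Variables (R : realType) (X1 X2 Y : completeNormedModType R).
Variable T : (X1 * X2)%type -> Y.
Hypothesis Tn : narrow T.

(** Here v is the sum of the first coordinates of the k vectors chosen so far
    and w the second coordinate of the last one, the only second coordinate
    that survives the telescoping.  The vector n x + v starts from norm n and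
    its norm never exceeds 2 n, so by norm_add_near_direction each stage loses
    at most 2 n d from the ideal increase 1. *)
Lemma narrow_telescope (x y : X1) (f : X1 -> R^o) (n : nat) (d : R) :
  unit_sphere x -> unit_sphere y -> bounded_linear f ->
  (0 < n)%N -> 0 < d -> 2 * n%:R * d <= 1 ->
  forall k, (k <= n)%N -> exists v : X1, exists w : X2,
  [/\ `|v| <= k%:R, `|w| <= 1,
      n%:R + k%:R * (1 - 2 * n%:R * d) <= `|n%:R *: x + v|,
      `|T (k%:R *: y - v, - w)| <= k%:R * d &
      `|f (k%:R *: y - v)| <= k%:R * d].
Proof.
rewrite /unit_sphere /= => x1 y1 fb n0 d0 hd.
have [[Tlin _] Tz] := Tn; have [flin _] := fb.
have n1 : 1 <= n%:R :> R by rewrite ler1n.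
elim=> [_|k IH kn].
  exists 0, 0; rewrite !normr0 !mul0r scale0r !addr0 !oppr0 !addr0.
  rewrite normrZ x1 mulr1 normr_nat.
  by rewrite (linear_fun0 Tlin) (linear_fun0 flin) !normr0; split.
have [v [w [hv hw hnv hT hf]]] := IH (ltnW kn).
set u := n%:R *: x + v in hnv *.
have kn' : k%:R <= n%:R :> R by rewrite ler_nat ltnW.
have nk : n%:R <= `|u|.
  by apply: le_trans hnv; rewrite lerDl mulr_ge0// subr_ge0.
have un : `|u| <= 2 * n%:R.
  by apply: le_trans (ler_normD _ _) _; rewrite normrZ x1 normr_nat; lra.
have u1 : 1 <= `|u| by apply: le_trans nk.
have d1 : d < 1 by nra.
have xs : `|(`|u|^-1 *: u, 0 : X2)| = 1.
  rewrite norm_pairE normr0 normrZ normfV normr_id mulVf ?max_l//.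
  by rewrite gt_eqF// (lt_le_trans _ u1).
have ys : `|(y, w)| = 1 by rewrite norm_pairE y1 max_l.
(* The target has second coordinate w, the previous leftover, so that the
   leftovers cancel in the sum. *)
have [[z1 z2]] := Tz _ _ xs ys _
  (bounded_linear_comp (bounded_linear_fst X1 X2) fb) _ d0.
rewrite /unit_sphere /= norm_pairE => z12 [hz hTf].
have z1_le1 : `|z1| <= 1 by rewrite -z12 le_max lexx.
have z2_le1 : `|z2| <= 1 by rewrite -z12 le_max lexx orbT.
have {}hz : 2 - d <= `| `|u|^-1 *: u + z1|.
  move: hz; rewrite norm_pairE /= add0r le_max => /orP[//|hz].
  (* The second coordinate cannot be the large one: |z2| <= 1 < 2 - d. *)
  by exfalso; lra.
have hT' : `|T (y - z1, w - z2)| <= d.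
  by apply: le_trans hTf; rewrite lerDl.
have hf' : `|f (y - z1)| <= d.
  by apply: le_trans hTf; rewrite lerDr.
have yE : k.+1%:R *: y - (v + z1) = (k%:R *: y - v) + (y - z1).
  by rewrite -natr1 scalerDl scale1r opprD addrACA.
have k1E : k.+1%:R = k%:R + 1 :> R by rewrite natr1.
exists (v + z1), z2; split=> //.
- by apply: le_trans (ler_normD _ _) _; rewrite k1E lerD.
- rewrite addrA -/u k1E.
  apply: le_trans (norm_add_near_direction u1 z1_le1 hz).
  have : d * `|u| <= 2 * n%:R * d by rewrite mulrC ler_wpM2r ?(ltW d0).
  lra.
- have -> : (k.+1%:R *: y - (v + z1), - z2) =
            (k%:R *: y - v, - w) + (y - z1, w - z2).
    by apply: injective_projections; rewrite /= ?yE// addrA addNr add0r.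
  rewrite (linear_funD Tlin); apply: le_trans (ler_normD _ _) _.
  by rewrite k1E mulrDl mul1r lerD.
- rewrite yE (linear_funD flin); apply: le_trans (ler_normD _ _) _.
  by rewrite k1E mulrDl mul1r lerD.
Qed.

(** The average p of n vectors given by narrow_telescope, normalised.  The
    number n makes the leftover |T (0, w)| / n at most e / 2; then h = 2 n d,
    the loss of norm at each stage, which also bounds 1 - |p|, is chosen small
    enough to absorb the normalisation under both T and f. *)
Lemma narrow_inl : narrow (fun x : X1 => T (x, 0)).
Proof.
have [Tb _] := Tn; have Sb := bounded_linear_comp (bounded_linear_inl X1 X2) Tb.
split=> // x y xs ys f fb e e0.
have x1 : `|x| = 1 by exact: xs.
have [M M0 hM] := bounded_linear_ge0 Tb.
have [N N0 hN] := bounded_linear_ge0 fb.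
have [Tlin _] := Tb; have [flin _] := fb.
pose n := (Num.truncn (2 * M / e)).+1.
have n_gt0 : (0 < n)%N by [].
have n0 : 0 < n%:R :> R by rewrite ltr0n.
have hMn : n%:R^-1 * M <= e / 2.
  rewrite mulrC ler_pdivrMr//.
  have : 2 * M / e < n%:R by exact: truncnS_gt.
  by rewrite ltr_pdivrMr//; lra.
(* The cap at 1 gives h <= 1 / 2, so that p is nonzero. *)
pose c := Num.min e 1.
have c0 : 0 < c by rewrite lt_min e0 ltr01.
have ce : c <= e by rewrite ge_min lexx.
have c1 : c <= 1 by rewrite ge_min lexx orbT.
have S0 : 0 < 1 + M + N by lra.
pose h := c / 2 / (1 + M + N).
have h0 : 0 < h by rewrite !divr_gt0.
have hE : h * (1 + M + N) = c / 2 by rewrite divfK ?gt_eqF.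
have hMN : 0 <= h * M /\ 0 <= h * N by split; apply: mulr_ge0 => //; exact: ltW.
pose d := h / (2 * n%:R).
have d0 : 0 < d by rewrite divr_gt0// mulr_gt0.
have dE : 2 * n%:R * d = h by rewrite mulrC divfK// gt_eqF// mulr_gt0.
have d_le : 2 * d <= h.
  have : 1 <= n%:R :> R by rewrite ler1n.
  by rewrite -dE; nra.
have h1 : 2 * n%:R * d <= 1 by rewrite dE; lra.
have [v [w [hv hw hxv hT hf]]] :=
  narrow_telescope xs ys fb n_gt0 d0 h1 (leqnn n).
rewrite dE in hxv.
pose p := n%:R^-1 *: v.
have nK (a : X1) : n%:R^-1 *: (n%:R *: a) = a.
  by rewrite scalerA mulVf ?scale1r ?gt_eqF.
have normVn (V : normedModType R) (a : V) : `|n%:R^-1 *: a| = n%:R^-1 * `|a|.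
  by rewrite normrZ normfV normr_nat.
have p1 : `|p| <= 1 by rewrite normVn mulrC ler_pdivrMr// mul1r.
have xp : 2 - h <= `|x + p|.
  rewrite -[x]nK -scalerDr normVn mulrC ler_pdivlMr//.
  lra.
have ph : 1 - h <= `|p| by have := ler_normD x p; lra.
have p0 : 0 < `|p| by lra.
have zp : `| `|p|^-1 *: p - p| <= h.
  rewrite -[X in _ - X]scale1r -scalerBl normrZ ger0_norm; last first.
    by rewrite subr_ge0 -invr1 lef_pV2 ?posrE.
  by rewrite mulrBl mulVf ?gt_eqF//; lra.
have zs : `| `|p|^-1 *: p| = 1.
  by rewrite normrZ normfV normr_id mulVf ?gt_eqF.
set z := `|p|^-1 *: p in zp zs *.
have yz : y - z = n%:R^-1 *: (n%:R *: y - v) - (z - p).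
  by rewrite scalerBr nK opprB addrA subrK.
exists z => //; split.
  have -> : x + z = (x + p) + (z - p) by rewrite addrACA subrr addr0.
  by apply: le_trans (lerB_normD _ _); lra.
have hTyz : `|T (y - z, 0)| <= d + e / 2 + M * h.
  (* Adding (0, w) cancels the leftover; this is the term divided by n. *)
  have -> : (y - z, 0) = n%:R^-1 *: ((n%:R *: y - v, - w) + (0, w))
      - (z - p, 0) :> X1 * X2.
    by apply: injective_projections => /=; rewrite ?addr0 ?addNr ?scaler0 ?subr0.
  rewrite (linear_funB Tlin) (linear_funZ Tlin) (linear_funD Tlin).
  apply: le_trans (ler_normB _ _) _; rewrite normVn; apply: lerD.
    apply: le_trans (_ : n%:R^-1 * (n%:R * d + M) <= _).
      apply: ler_wpM2l; first by rewrite invr_ge0 ltW.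
      apply: le_trans (ler_normD _ _) _; apply: lerD => //.
      apply: le_trans (hM _) _; rewrite norm_pairE normr0 max_r//.
      by rewrite ler_piMr.
    by rewrite mulrDr mulrA mulVf ?gt_eqF// mul1r lerD2l.
  apply: le_trans (hM _) _; rewrite norm_pairE normr0 max_l//.
  by rewrite ler_wpM2l.
have hfyz : `|f (y - z)| <= d + N * h.
  rewrite yz (linear_funB flin) (linear_funZ flin).
  apply: le_trans (ler_normB _ _) _; rewrite normVn; apply: lerD.
    by rewrite mulrC ler_pdivrMr// mulrC.
  by apply: le_trans (hN _) _; rewrite ler_wpM2l.
have : d + e / 2 + M * h + (d + N * h) <= e by lra.
by apply: le_trans; rewrite lerD.
Qed.

End narrow_sum.

Lemma narrow_swap (R : realType) (X1 X2 Y : completeNormedModType R)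
    (T : (X1 * X2)%type -> Y) :
  narrow T -> narrow (fun p : (X2 * X1)%type => T (p.2, p.1)).
Proof.
move=> [Tb Tz]; split; first exact: bounded_linear_comp (bounded_linear_swap _ _) Tb.
move=> [x1 x2] [y1 y2]; rewrite /unit_sphere /= !norm_pairE => hx hy f fb e e0.
have hx' : `|(x2, x1)| = 1 by rewrite norm_pairE maxC.
have hy' : `|(y2, y1)| = 1 by rewrite norm_pairE maxC.
have [[z1 z2]] := Tz _ _ hx' hy' _
  (bounded_linear_comp (bounded_linear_swap _ _) fb) _ e0.
rewrite /unit_sphere /= norm_pairE => hz [h1 h2].
exists (z2, z1); rewrite /= ?norm_pairE; first by rewrite maxC.
by split=> //; move: h1; rewrite !norm_pairE maxC.
Qed.

Theorem corollary3p5 (R : realType) (X1 X2 Y : completeNormedModType R)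
    (T : (X1 * X2)%type -> Y) :
  narrow T ->
  narrow (fun x1 : X1 => T (x1, 0)) /\ narrow (fun x2 : X2 => T (0, x2)).
Proof.
by move=> Tn; split; [exact: narrow_inl|exact: narrow_inl (narrow_swap Tn)].
Qed.
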